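(* Let $\mathcal{K}$ be a class of fields. If the free group on two generators is $\mathcal{K}$-resistant, then so is the free product of any family of torsion-free abelian groups.
   Context: For a field $k$, a group $G$ is called $k$-resistant if for every $r$ in the group algebra $k\,G$ with support (set of group elements having nonzero coefficient) of cardinality $>1$, the two-sided ideal of $k\,G$ generated by $r$ is proper. For a class $\mathcal{K}$ of fields, $G$ is $\mathcal{K}$-resistant if it is $k$-resistant for all $k\in\mathcal{K}$. Families may be finite or infinite. *)

(* Defs.v *)
From HB Require Import structures.
From mathcomp Require Import all_boot all_algebra finmap.
From mathcomp Require Import boolp classical_sets.
From mathcomp.multinomials Require Import monalg.

Set Implicit Arguments.
Unset Strict Implicit.
Unset Printing Implicit Defensive.

Import GRing.Theory.

Local Open Scope quotient_scope.
Local Open Scope group_scope.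

(* Equality of words in the group generated by L subject to the relations R,  *)
(* where linv l is a letter denoting the inverse of l.                        *)
Inductive word_eq (L : Type) (linv : L -> L) (R : seq L -> seq L -> Prop) :
    seq L -> seq L -> Prop :=
| WordRel u v : R u v -> word_eq linv R u v
| WordInvR l : word_eq linv R [:: l; linv l] [::]
| WordInvL l : word_eq linv R [:: linv l; l] [::]
| WordCat u u' v v' : word_eq linv R u u' -> word_eq linv R v v' ->
    word_eq linv R (u ++ v) (u' ++ v')
| WordRefl u : word_eq linv R u u
| WordSym u v : word_eq linv R u v -> word_eq linv R v u
| WordTrans u v w : word_eq linv R u v -> word_eq linv R v w ->
    word_eq linv R u w.

Section PresentedGroup.
Context (L : Type) (linv : L -> L) (R : seq L -> seq L -> Prop).

Definition word_eqb : rel (seq {classic L}) :=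
  fun u v => `[< word_eq linv R u v >].

Lemma word_eqb_refl : reflexive word_eqb.
Proof. by move=> u; apply/asboolP; apply: WordRefl. Qed.

Lemma word_eqb_sym : symmetric word_eqb.
Proof. by move=> u v; apply/asboolP/asboolP; apply: WordSym. Qed.

Lemma word_eqb_trans : transitive word_eqb.
Proof.
by move=> v u w /asboolP uv /asboolP vw; apply/asboolP; apply: WordTrans uv vw.
Qed.

Canonical word_equiv :=
  EquivRel word_eqb word_eqb_refl word_eqb_sym word_eqb_trans.

Definition presented := {eq_quot word_equiv}.
HB.instance Definition _ := Choice.on presented.

Definition word_class (w : seq L) : presented := \pi_({eq_quot word_equiv}) w.

Lemma word_classP u v : word_class u = word_class v <-> word_eq linv R u v.
Proof. by split=> [/eqmodP/asboolP|uv]; last apply/eqmodP/asboolP. Qed.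

Lemma word_class_repr (x : presented) : word_class (repr x) = x.
Proof. exact: reprK. Qed.

Definition presented_mul (x y : presented) := word_class (repr x ++ repr y).
Definition presented_one := word_class [::].
Definition presented_inv (x : presented) :=
  word_class (rev (map linv (repr x))).

Lemma presented_mulE u v :
  presented_mul (word_class u) (word_class v) = word_class (u ++ v).
Proof.
by apply/word_classP/WordCat; apply/word_classP; rewrite word_class_repr.
Qed.

Lemma presented_mulA : associative presented_mul.
Proof.
move=> x y z; rewrite -(word_class_repr x) -(word_class_repr y).
by rewrite -(word_class_repr z) !presented_mulE catA.
Qed.

Lemma presented_mul1 : left_id presented_one presented_mul.
Proof. by move=> x; rewrite -(word_class_repr x) presented_mulE. Qed.

Lemma presented_mulr1 : right_id presented_one presented_mul.
Proof. by move=> x; rewrite -(word_class_repr x) presented_mulE cats0. Qed.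

Lemma presented_mulV : left_inverse presented_one presented_inv presented_mul.
Proof.
move=> x; rewrite -[X in presented_mul _ X](word_class_repr x) presented_mulE.
apply/word_classP; elim: (repr x : seq L) => [|l w IHw]; first exact: WordRefl.
rewrite map_cons rev_cons -cats1 -catA [_ ++ _ :: _]/=.
apply: WordTrans IHw; apply: WordCat; first exact: WordRefl.
by apply: (@WordCat _ _ _ [:: _; _] [::]); [apply: WordInvL|apply: WordRefl].
Qed.

Lemma presented_mulrV : right_inverse presented_one presented_inv presented_mul.
Proof.
move=> x; rewrite -[X in presented_mul X _](word_class_repr x) presented_mulE.
apply/word_classP; elim: (repr x : seq L) => [|l w IHw]; first exact: WordRefl.
rewrite map_cons rev_cons -cats1 catA.
apply: WordTrans (WordInvR _ _ l).
apply: (@WordCat _ _ _ _ [:: l]); last exact: WordRefl.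
by apply: (@WordCat _ _ _ [:: l] [:: l] _ [::]); first exact: WordRefl.
Qed.

HB.instance Definition _ := isGroup.Build presented
  presented_mulA presented_mul1 presented_mulr1 presented_mulV presented_mulrV.

Lemma word_classM u v : word_class (u ++ v) = word_class u * word_class v.
Proof. by rewrite -presented_mulE. Qed.

Lemma word_class0 : word_class [::] = 1.
Proof. by []. Qed.

Lemma presented_lift (H : groupType) (f : L -> H)
    (fV : forall l, f (linv l) = (f l)^-1)
    (fR : forall u v, R u v -> \prod_(l <- u) f l = \prod_(l <- v) f l) :
  exists g : {multiplicative presented -> H},
    forall w, g (word_class w) = \prod_(l <- w) f l.
Proof.
have fE u v : word_eq linv R u v -> \prod_(l <- u) f l = \prod_(l <- v) f l.
  elim=> {u v} [u v||||u|//|u v w _ -> _ ->] //; first exact: fR.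
  - by move=> l; rewrite !big_cons !big_nil fV mulg1 mulgV.
  - by move=> l; rewrite !big_cons !big_nil fV mulg1 mulVg.
  - by move=> u u' v v' _ IHu _ IHv; rewrite !big_cat IHu IHv.
pose g (x : presented) := \prod_(l <- (repr x : seq L)) f l.
have gE w : g (word_class w) = \prod_(l <- w) f l.
  by apply/fE/word_classP; rewrite word_class_repr.
have gM : {morph g : x y / x * y}.
  move=> x y; rewrite -(word_class_repr x) -(word_class_repr y) -word_classM.
  by rewrite !gE big_cat.
by exists (HB.pack_for {multiplicative presented -> H} g
  (monoid.isMultiplicative.Build _ _ g gM)).
Qed.

Lemma presented_ext (H : groupType) (g h : {multiplicative presented -> H}) :
  (forall l, g (word_class [:: l]) = h (word_class [:: l])) -> g =1 h.
Proof.
have m1 (k : {multiplicative presented -> H}) : k 1 = 1.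
  by apply: (mulgI (k 1)); rewrite -gmulfM !mulg1.
move=> gh x; rewrite -(word_class_repr x).
elim: (repr x : seq L) => [|l w IHw]; first by rewrite word_class0 !m1.
by rewrite -cat1s word_classM !gmulfM gh IHw.
Qed.

End PresentedGroup.

(* The letter (x, true) is the generator x and (x, false) is its inverse. *)
Definition free_group (X : Type) : groupType :=
  @presented (X * bool) (fun l => (l.1, ~~ l.2)) (fun _ _ => False).

Definition free_gen (X : Type) (x : X) : free_group X :=
  word_class _ _ [:: (x, true)].

Lemma free_group_lift (X : Type) (H : groupType) (f : X -> H) :
  exists g : {multiplicative free_group X -> H}, forall x, g (free_gen x) = f x.
Proof.
have [||g gE] := @presented_lift (X * bool) (fun l => (l.1, ~~ l.2))
  (fun _ _ => False) H (fun l => if l.2 then f l.1 else (f l.1)^-1).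
- by case=> x [] /=; rewrite ?invgK.
- by [].
by exists g => x; rewrite gE big_cons big_nil mulg1.
Qed.

Lemma free_group_ext (X : Type) (H : groupType)
    (g h : {multiplicative free_group X -> H}) :
  (forall x, g (free_gen x) = h (free_gen x)) -> g =1 h.
Proof.
have m1 (k : {multiplicative free_group X -> H}) : k 1 = 1.
  by apply: (mulgI (k 1)); rewrite -gmulfM !mulg1.
move=> gh; apply: presented_ext => -[x []]; first exact: gh.
have e : free_gen x * word_class _ _ [:: (x, false)] = 1 :> free_group X.
  by rewrite -word_classM -word_class0; apply/word_classP/(WordInvR _ _ (x, true)).
apply: (mulgI (g (free_gen x))); rewrite -[LHS]gmulfM [in RHS]gh.
by rewrite -[RHS]gmulfM !e !m1.
Qed.

Section FreeProduct.
Context (I : Type) (A : I -> groupType).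

Definition letter (i : I) (a : A i) : {i : I & A i} := existT _ i a.

Inductive free_product_rel :
    seq {i : I & A i} -> seq {i : I & A i} -> Prop :=
| FreeProductMul i (a b : A i) :
    free_product_rel [:: letter a; letter b] [:: letter (a * b)]
| FreeProductOne i : free_product_rel [:: letter (1 : A i)] [::].

(* That (i, a) and (i, a^-1) cancel already follows from free_product_rel, so *)
(* the cancellation relations of word_eq add nothing here.                    *)
Definition free_product : groupType :=
  presented (fun l : {i : I & A i} => letter (projT2 l)^-1) free_product_rel.

Definition free_product_in (i : I) (a : A i) : free_product :=
  word_class _ _ [:: letter a].

Lemma free_product_inM (i : I) : {morph @free_product_in i : a b / a * b}.
Proof.
move=> a b; rewrite -[RHS]word_classM; apply/esym/word_classP/WordRel.
exact: FreeProductMul.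
Qed.

Lemma free_product_lift (H : groupType) (f : forall i, {multiplicative A i -> H}) :
  exists g : {multiplicative free_product -> H},
    forall i (a : A i), g (free_product_in a) = f i a.
Proof.
have f1 i : f i 1 = 1 by apply: (mulgI (f i 1)); rewrite -gmulfM !mulg1.
have [||g gE] := @presented_lift {i : I & A i}
  (fun l => letter (projT2 l)^-1) free_product_rel H
  (fun l => f (projT1 l) (projT2 l)).
- case=> i a /=; apply: (mulgI (f i a)).
  by rewrite -gmulfM !mulgV f1.
- move=> u v [i a b|i]; rewrite !big_cons !big_nil !mulg1 /=.
    by rewrite gmulfM.
  exact: f1.
by exists g => i a; rewrite gE big_cons big_nil mulg1.
Qed.

Lemma free_product_ext (H : groupType)
    (g h : {multiplicative free_product -> H}) :
  (forall i (a : A i), g (free_product_in a) = h (free_product_in a)) ->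
  g =1 h.
Proof. by move=> gh; apply: presented_ext => -[i a]; exact: gh. Qed.

End FreeProduct.

Definition abelian_group (G : groupType) : Prop :=
  forall x y : G, x * y = y * x.

Definition torsion_free (G : groupType) : Prop :=
  forall (x : G) (n : nat), (0 < n)%N -> x ^+ n = 1 -> x = 1.

Local Close Scope group_scope.
Local Open Scope ring_scope.

(* The library puts a ring structure on {malg k[M]} only for monoids M whose  *)
(* sole unit is 1, hence the alias.                                           *)
Definition group_algebra (k : fieldType) (G : groupType) : Type := {malg k[G]}.

Section GroupAlgebra.
Context (k : fieldType) (G : groupType).
Implicit Types g : {malg k[G]}.

HB.instance Definition _ := GRing.Lmodule.on (group_algebra k G).

Definition ga_one : {malg k[G]} := << 1%g >>.

Definition ga_mul g1 g2 : {malg k[G]} :=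
  \sum_(x <- msupp g1) \sum_(y <- msupp g2) << g1@_x * g2@_y *g (x * y)%g >>.

Lemma ga_mulw (d1 d2 : {fset G}) g1 g2 :
    (msupp g1 `<=` d1)%fset -> (msupp g2 `<=` d2)%fset ->
  ga_mul g1 g2 =
    \sum_(x <- d1) \sum_(y <- d2) << g1@_x * g2@_y *g (x * y)%g >>.
Proof.
move=> le_d1 le_d2; rewrite /ga_mul (big_fset_incl _ le_d1) /=.
  apply/eq_bigr=> x _; apply/big_fset_incl => // y _ /mcoeff_outdom ->.
  by rewrite mulr0 monalgU0.
move=> x _ /mcoeff_outdom g1x.
by rewrite big1 => // y _; rewrite g1x mul0r monalgU0.
Qed.

Lemma ga_mulUU (c1 c2 : k) (x y : G) :
  ga_mul << c1 *g x >> << c2 *g y >> = << c1 * c2 *g (x * y)%g >>.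
Proof. by rewrite (ga_mulw msuppU_le msuppU_le) !big_seq_fset1 !mcoeffUU. Qed.

Lemma ga_mul0l : left_zero 0 ga_mul.
Proof. by move=> g; rewrite /ga_mul msupp0 big_seq_fset0. Qed.

Lemma ga_mul0r : right_zero 0 ga_mul.
Proof.
by move=> g; rewrite /ga_mul big1 // => x _; rewrite msupp0 big_seq_fset0.
Qed.

Lemma ga_mulDl : left_distributive ga_mul +%R.
Proof.
move=> g1 g2 g; have le_g := fsubset_refl (msupp g).
rewrite (ga_mulw (msuppD_le g1 g2) le_g).
rewrite (ga_mulw (fsubsetUl (msupp g1) (msupp g2)) le_g).
rewrite (ga_mulw (fsubsetUr (msupp g1) (msupp g2)) le_g).
rewrite -big_split /=; apply/eq_bigr=> x _.
rewrite -big_split /=; apply/eq_bigr=> y _.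
by rewrite mcoeffD mulrDl monalgUD.
Qed.

Lemma ga_mulDr : right_distributive ga_mul +%R.
Proof.
move=> g g1 g2; have le_g := fsubset_refl (msupp g).
rewrite (ga_mulw le_g (msuppD_le g1 g2)).
rewrite (ga_mulw le_g (fsubsetUl (msupp g1) (msupp g2))).
rewrite (ga_mulw le_g (fsubsetUr (msupp g1) (msupp g2))).
rewrite -big_split /=; apply/eq_bigr=> x _.
rewrite -big_split /=; apply/eq_bigr=> y _.
by rewrite mcoeffD mulrDr monalgUD.
Qed.

Lemma ga_mul_suml (J : Type) (s : seq J) (F : J -> {malg k[G]}) g :
  ga_mul (\sum_(j <- s) F j) g = \sum_(j <- s) ga_mul (F j) g.
Proof.
exact: (big_morph (ga_mul^~ g) (fun _ _ => ga_mulDl _ _ _) (ga_mul0l g)).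
Qed.

Lemma ga_mul_sumr (J : Type) (s : seq J) (F : J -> {malg k[G]}) g :
  ga_mul g (\sum_(j <- s) F j) = \sum_(j <- s) ga_mul g (F j).
Proof.
exact: (big_morph (ga_mul g) (fun _ _ => ga_mulDr _ _ _) (ga_mul0r g)).
Qed.

Lemma ga_mulA : associative ga_mul.
Proof.
move=> g1 g2 g3; rewrite (monalgE g1) !ga_mul_suml; apply/eq_bigr=> x _.
rewrite (monalgE g2) !(ga_mul_suml, ga_mul_sumr); apply/eq_bigr=> y _.
rewrite (monalgE g3) !ga_mul_sumr; apply/eq_bigr=> z _.
by rewrite !ga_mulUU mulrA mulgA.
Qed.

Lemma ga_mul1l : left_id ga_one ga_mul.
Proof.
move=> g; rewrite (monalgE g) ga_mul_sumr; apply/eq_bigr=> x _.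
by rewrite ga_mulUU mul1r mul1g.
Qed.

Lemma ga_mul1r : right_id ga_one ga_mul.
Proof.
move=> g; rewrite (monalgE g) ga_mul_suml; apply/eq_bigr=> x _.
by rewrite ga_mulUU mulr1 mulg1.
Qed.

Lemma ga_one_neq0 : ga_one != 0.
Proof. by rewrite /ga_one monalgU_eq0 oner_eq0. Qed.

HB.instance Definition _ := GRing.Zmodule_isNzRing.Build (group_algebra k G)
  ga_mulA ga_mul1l ga_mul1r ga_mulDl ga_mulDr ga_one_neq0.

End GroupAlgebra.

Local Open Scope classical_set_scope.

Definition two_sided_ideal (R : nzRingType) (J : set R) : Prop :=
  [/\ J 0,
      forall x y, J x -> J y -> J (x + y),
      forall a x, J x -> J (a * x)
    & forall x b, J x -> J (x * b)].

Definition generated_ideal (R : nzRingType) (r : R) : set R :=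
  smallest (@two_sided_ideal R) [set r].

Definition proper_ideal (R : nzRingType) (J : set R) : Prop := J <> setT.

Definition k_resistant (k : fieldType) (G : groupType) : Prop :=
  forall r : group_algebra k G,
    (1 < #|` msupp r|)%N -> proper_ideal (generated_ideal r).

Definition class_resistant (K : fieldType -> Prop) (G : groupType) : Prop :=
  forall k : fieldType, K k -> k_resistant k G.

(* Main.v *)
From HB Require Import structures.
From mathcomp Require Import all_boot all_order all_algebra finmap.
From mathcomp Require Import boolp classical_sets.
From mathcomp Require Import ring zify.
From mathcomp.multinomials Require Import monalg.
Require Import Defs.

(** Let [G] be the free product of the torsion-free abelian groups [A i]. It
  need not embed into a free group: a divisible factor such as the additive
  group of the rationals has no nontrivial homomorphism to one. But [G] embeds
  locally into the free group [F] of rank 2: for every finite subset [E] of [G]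
  there is a map from [G] to [F], multiplicative on pairs of elements of [E] and
  injective on [E] ([free_product_locally_embeds]).

  Local embeddings suffice. If the ideal generated by [r] contains 1, then this
  is witnessed by one identity 1 = a_1 r b_1 + ... + a_n r b_n, which involves
  finitely many products of group elements. A map that respects these products
  and is injective on the support of [r] carries the identity to the group
  algebra of [F], where it shows that the image of [r], whose support still has
  more than one element, generates the whole algebra
  ([locally_embeds_resistant]).

  To embed [G] locally, represent its elements by words in the letters (i, a)
  with [a] in [A i]. The finitely many equalities of words that matter follow
  from finitely many multiplications of letters ([word_eq_local]), so it is
  enough to send (i, a) to [c_i ^ h_i(a)], where the [c_i] are elements of [F]
  and [h_i] is an integer valued function, additive on a given finite subset of
  [A i]. Since [A i] is torsion-free, [h_i] can be chosen nonzero on the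
  nontrivial elements of that subset ([torsion_free_abelian_weight]). For
  injectivity, write [x^-1 y], for distinct [x] and [y] in [E], as a word whose
  letters are nontrivial and in which neighbours come from different factors
  ([word_reduced]). Its image is a product of nonzero powers of the [c_i] with
  distinct neighbouring indices. This is nontrivial when the [c_i] are free
  generators of a subgroup of [F]; the conjugates [s^-i t s^i] of one free
  generator [t] of [F] by the powers of the other one, [s], are such
  ([conj_gen_prod_neq1]). *)

Set Implicit Arguments.
Unset Strict Implicit.
Unset Printing Implicit Defensive.

Import Order.TTheory GRing.Theory Num.Theory.

(** * Local embeddings and ideals of group algebras *)

Definition locally_embeds (G H : groupType) : Prop :=
  forall E : seq G, exists phi : G -> H,
    {in E &, {morph phi : x y / (x * y)%g}} /\ {in E &, injective phi}.

Section PushForward.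
Context (k : fieldType) (G H : groupType) (phi : G -> H).
Local Open Scope ring_scope.
Implicit Types g : {malg k[G]}.

Definition push g : {malg k[H]} := \sum_(x <- msupp g) << g@_x *g phi x >>.

Lemma pushEw (d : {fset G}) g : (msupp g `<=` d)%fset ->
  push g = \sum_(x <- d) << g@_x *g phi x >>.
Proof.
move=> le_d; apply: big_fset_incl => // x _ /mcoeff_outdom ->.
by rewrite monalgU0.
Qed.

Lemma pushU c x : push << c *g x >> = << c *g phi x >>.
Proof. by rewrite (pushEw msuppU_le) big_seq_fset1 mcoeffUU. Qed.

Lemma pushD : {morph push : g1 g2 / g1 + g2}.
Proof.
move=> g1 g2; rewrite (pushEw (msuppD_le g1 g2)).
rewrite (pushEw (fsubsetUl (msupp g1) (msupp g2))).
rewrite (pushEw (fsubsetUr (msupp g1) (msupp g2))) -big_split /=.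
by apply/eq_bigr => x _; rewrite mcoeffD monalgUD.
Qed.

Lemma push0 : push 0 = 0.
Proof. by rewrite /push msupp0 big_seq_fset0. Qed.

Lemma push_sum (J : Type) (s : seq J) (F : J -> {malg k[G]}) :
  push (\sum_(j <- s) F j) = \sum_(j <- s) push (F j).
Proof. exact: (big_morph push pushD push0). Qed.

(** The linear extension of [phi] multiplies two elements correctly as soon as
  [phi] does so on their supports. *)
Lemma pushM g1 g2 :
    {in msupp g1 & msupp g2, {morph phi : x y / (x * y)%g}} ->
  push (ga_mul g1 g2) = ga_mul (push g1) (push g2).
Proof.
move=> phiM; rewrite {1}/ga_mul push_sum [push g1]/push ga_mul_suml.
rewrite big_seq [RHS]big_seq; apply/eq_bigr => x xg1.
rewrite push_sum [push g2]/push ga_mul_sumr big_seq [RHS]big_seq.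
by apply/eq_bigr => y yg2; rewrite pushU ga_mulUU phiM.
Qed.

Lemma mcoeff_push g x : {in msupp g &, injective phi} -> x \in msupp g ->
  (push g)@_(phi x) = g@_x.
Proof.
move=> phi_inj xg; rewrite /push raddf_sum /= (big_fsetD1 x) //= mcoeffU eqxx.
rewrite mulr1n big_seq big1 ?addr0 // => y; rewrite !inE => /andP[yx yg].
rewrite mcoeffU; case: eqP => // /phi_inj e.
by rewrite e ?eqxx in yx.
Qed.

(** Distinct elements of the support keep distinct images, so that no
  coefficient is lost to cancellation. *)
Lemma card_push_gt1 g : {in msupp g &, injective phi} ->
  (1 < #|` msupp g|)%N -> (1 < #|` msupp (push g)|)%N.
Proof.
move=> phi_inj g1; apply: leq_trans g1 _.
rewrite -(card_in_imfset imfset_key phi_inj); apply: fsubset_leq_card.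
apply/fsubsetP => _ /imfsetP[x /= xg ->].
by rewrite -mcoeff_neq0 mcoeff_push // mcoeff_neq0.
Qed.

End PushForward.

Section Ideal.
Context (R : nzRingType).
Local Open Scope ring_scope.

Lemma two_sided_ideal_generated (r : R) : two_sided_ideal (generated_ideal r).
Proof.
split=> [J [[] //]|x y Jx Jy J JI|a x Jx J JI|x b Jx J JI].
- by have [_ JD _ _] := JI.1; apply: JD; [apply: Jx|apply: Jy].
- by have [_ _ JM _] := JI.1; apply: JM; apply: Jx.
- by have [_ _ _ JM] := JI.1; apply: JM; apply: Jx.
Qed.

(** A finite witness of membership: this is what reduces a statement on the
  ideal to finitely many group elements. *)
Lemma generated_idealP (r x : R) : generated_ideal r x <->
  exists s : seq (R * R), x = \sum_(ab <- s) ab.1 * r * ab.2.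
Proof.
have [J0 JD Jl Jr] := two_sided_ideal_generated r.
have Jself : generated_ideal r r by move=> J [_]; apply.
split=> [|[s ->]]; last first.
  by elim/big_ind: _ => // ab _; apply: (Jr); apply: (Jl).
pose J : set R := [set y | exists s : seq (R * R),
  y = \sum_(ab <- s) ab.1 * r * ab.2]%classic.
move/(_ J); apply; split=> [|_ ->]; last first.
  by exists [:: (1, 1)]; rewrite big_seq1 mul1r mulr1.
split.
- by exists [::]; rewrite big_nil.
- by move=> _ _ [s ->] [t ->]; exists (s ++ t); rewrite big_cat.
- move=> a _ [s ->]; exists [seq (a * ab.1, ab.2) | ab <- s].
  by rewrite big_map mulr_sumr; apply/eq_bigr => ab _; rewrite !mulrA.
- move=> _ b [s ->]; exists [seq (ab.1, ab.2 * b) | ab <- s].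
  by rewrite big_map mulr_suml; apply/eq_bigr => ab _; rewrite !mulrA.
Qed.

Lemma proper_generated_idealP (r : R) :
  proper_ideal (generated_ideal r) <-> ~ generated_ideal r 1.
Proof.
have [_ _ Jl _] := two_sided_ideal_generated r.
split=> [Jp J1|J1 e]; last by apply: J1; rewrite e.
by apply: Jp; apply/seteqP; split=> // x _; rewrite -(mulr1 x); apply: Jl.
Qed.

End Ideal.

(** The set [E] below consists of the group elements that occur in an identity
  1 = a_1 r b_1 + ... + a_n r b_n; containing the supports of the [a_i r]
  themselves, it lets the triple products be treated as two successive ones. *)
Lemma locally_embeds_resistant (k : fieldType) (G H : groupType) :
  locally_embeds G H -> k_resistant k H -> k_resistant k G.
Proof.
move=> GH Hres r r1; apply/proper_generated_idealP => /generated_idealP[s e].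
pose supp (g : group_algebra k G) : seq G := msupp (g : {malg k[G]}).
pose E := (1%g : G) :: supp r ++
  flatten [seq supp ab.1 ++ supp (ab.1 * r)%R ++ supp ab.2 | ab <- s].
have [phi [phiM phi_inj]] := GH E.
have E1 : (1%g : G) \in E by rewrite inE eqxx.
have Er : {subset supp r <= E} by move=> x xr; rewrite inE mem_cat xr orbT.
have Es ab : ab \in s ->
    {subset supp ab.1 ++ supp (ab.1 * r)%R ++ supp ab.2 <= E}.
  move=> abs x xab; rewrite inE mem_cat; apply/or3P/Or33/flattenP.
  by exists (supp ab.1 ++ supp (ab.1 * r)%R ++ supp ab.2) => //; apply: map_f.
have phi1 : phi 1%g = 1%g.
  by apply: (mulgI (phi 1%g)); rewrite -phiM // !mulg1.
have /proper_generated_idealP := Hres _ (card_push_gt1 (sub_in2 Er phi_inj) r1).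
apply; apply/generated_idealP.
exists [seq (push phi (ab.1 : {malg k[G]}) : group_algebra k H,
             push phi (ab.2 : {malg k[G]}) : group_algebra k H) | ab <- s].
have -> : (1%R : group_algebra k H) = push phi (1%R : group_algebra k G).
  by rewrite [RHS]pushU phi1.
rewrite e [LHS]push_sum big_map big_seq [RHS]big_seq.
apply: eq_bigr => ab /Es abE /=.
rewrite [LHS]pushM; last first.
  by move=> x y xs ys; apply: phiM; apply: abE; rewrite !mem_cat (xs, ys) !orbT.
congr (ga_mul _ _); apply: pushM => x y xs ys; apply: phiM; last exact: Er.
by apply: abE; rewrite mem_cat xs.
Qed.

(** * Integer weights on torsion-free abelian groups *)

Section TorsionFreeWeights.
Local Open Scope ring_scope.

(** A root of [x j + y j * 'X] is at most [`|x j|] in absolute value, hence less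
  than 1 plus the sum of all these. *)
Lemma avoid_roots (J : finType) (x y : J -> int) :
  exists N : int, forall j, y j != 0 -> x j + N * y j != 0.
Proof.
exists (1 + \sum_j `|x j|) => j yj.
have : `|x j| <= \sum_j `|x j|.
  by rewrite (bigD1 j) //= lerDl sumr_ge0.
move: (\sum__ _) => N xN; rewrite addr_eq0; apply/eqP => e.
have : `|x j| = (1 + N) * `|y j|.
  by rewrite e normrN normrM (@ger0_norm _ (1 + N)) //; lia.
have : 1 <= `|y j| by lia.
nia.
Qed.

Section TorsionFreeZmodule.
Context (V : zmodType).
Context (V_tf : forall (x : V) n, (0 < n)%N -> x *+ n = 0 -> x = 0).

Lemma torsion_free_mulrz (x : V) (d : int) : d != 0 -> x *~ d = 0 -> x = 0.
Proof.
case: d => n; first by rewrite -lt0n; apply: V_tf.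
by move=> _ /eqP; rewrite NegzE mulrNz oppr_eq0 => /eqP; apply: V_tf.
Qed.

(** The weights define a homomorphism to the integers, with [a i] sent to [w i],
  on the subgroup that the [a i] generate: elements of the subgroup are handled
  as vectors of coefficients, and the first condition on [w] makes it well defined.
  Adding one generator [a n], there are two cases. If no nonzero multiple of
  [a n] is a combination of the previous generators, then its weight is free,
  and it only has to avoid finitely many values. Otherwise a relation [u0] with
  [d = u0 n] nonzero forces the weight of [a n], up to the scaling by [d] which
  keeps the weights integral; multiplying a vector by [d] and subtracting a
  multiple of [u0] eliminates [a n] from it, and no nonzero element becomes zero
  because [V] is torsion-free. *)
Lemma separating_weights (J : finType) n (a : nat -> V) (v : J -> nat -> int) :
  exists w : nat -> int,
    (forall u : nat -> int,
       \sum_(i < n) a i *~ u i = 0 -> \sum_(i < n) w i * u i = 0) /\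
    (forall j, \sum_(i < n) a i *~ v j i != 0 ->
               \sum_(i < n) w i * v j i != 0).
Proof.
elim: n v => [|n IH] v.
  by exists (fun=> 0); split=> [u _|j]; rewrite !big_ord0 ?eqxx.
have [[u0 [u0a d0]]|indep] := pselect (exists u0 : nat -> int,
    \sum_(i < n.+1) a i *~ u0 i = 0 /\ u0 n != 0).
- set d := u0 n in d0 *; pose red (v : nat -> int) i := d * v i - v n * u0 i.
  have red_sum (u : nat -> int) : \sum_(i < n) a i *~ red u i =
      (\sum_(i < n.+1) a i *~ u i) *~ d.
    transitivity (\sum_(i < n.+1) (a i *~ u i *~ d - a i *~ u0 i *~ u n)).
      rewrite big_ord_recr /= -!mulrzA [u n * d]mulrC subrr addr0.
      apply: eq_bigr => i _; rewrite -!mulrzA -mulrzBr /red.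
      by congr (_ *~ _); ring.
    by rewrite sumrB -!mulrz_suml u0a mul0rz subr0.
  have [w [wrel wsep]] := IH (fun j => red (v j)).
  pose w' i := if i == n then - \sum_(i < n) w i * u0 i else d * w i.
  have w'_sum (u : nat -> int) :
      \sum_(i < n.+1) w' i * u i = \sum_(i < n) w i * red u i.
    rewrite big_ord_recr /= /w' eqxx mulNr mulr_suml -sumrB.
    apply: eq_bigr => i _; rewrite ltn_eqF //= /red; ring.
  exists w'; split=> [u ua|j vj]; rewrite w'_sum.
    by apply: wrel; rewrite red_sum ua mul0rz.
  apply: wsep; rewrite red_sum; apply: contra vj => /eqP e.
  exact/eqP/(torsion_free_mulrz d0).
- have [w [wrel wsep]] := IH v.
  have [N NP] := avoid_roots (fun j => \sum_(i < n) w i * v j i)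
                             (fun j => v j n).
  pose w' i := if i == n then N else w i.
  have w'_sum (u : nat -> int) :
      \sum_(i < n.+1) w' i * u i = \sum_(i < n) w i * u i + N * u n.
    rewrite big_ord_recr /= /w' eqxx; congr (_ + _).
    by apply: eq_bigr => i _; rewrite ltn_eqF.
  exists w'; split=> [u ua|j]; rewrite w'_sum.
    have un : u n = 0.
      by apply/eqP/negP => /negP un; apply: indep; exists u.
    by rewrite un mulr0 addr0 wrel // -[RHS]ua big_ord_recr /= un addr0.
  have [vn|/NP //] := eqVneq (v j n) 0.
  by rewrite vn mulr0 addr0 big_ord_recr /= vn addr0; apply: wsep.
Qed.

(** The generators to be weighted are the elements of [E] together with their
  pairwise sums: then additivity on [E] is the well-definedness of the weights
  for the relations between [x], [y] and [x + y]. *)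
Lemma zmod_local_weight (E : seq V) : exists h : V -> int,
  {in E &, {morph h : x y / x + y}} /\ {in E, forall x, h x = 0 -> x = 0}.
Proof.
pose s := E ++ [seq x + y | x <- E, y <- E].
pose delta (j i : nat) : int := (i == j)%:R.
have sumD (U : zmodType) (b : nat -> U) (j : nat) : (j < size s)%N ->
    \sum_(i < size s) b i *~ delta j i = b j.
  move=> js; rewrite (bigD1 (Ordinal js)) //= /delta eqxx big1 ?addr0 // => i.
  by rewrite -val_eqE /= => /negPf ->.
have [w [wrel wsep]] := separating_weights (size s) (nth 0 s)
  (fun j : 'I_(size s) => delta j).
pose h x := w (index x s).
have hs x : x \in s -> \sum_(i < size s) w i * delta (index x s) i = h x.
  rewrite -index_mem => xs; rewrite -[RHS](sumD _ w _ xs).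
  by apply: eq_bigr => i _; rewrite mulrzz.
have eval_at x : x \in s ->
    \sum_(i < size s) nth 0 s i *~ delta (index x s) i = x.
  by move=> xs; rewrite sumD ?index_mem ?nth_index.
have Es x : x \in E -> x \in s by rewrite mem_cat => ->.
exists h; split=> [x y xE yE|x /Es xs].
  have xys : x + y \in s.
    by rewrite mem_cat; apply/orP; right; apply: allpairs_f.
  pose u i := delta (index (x + y) s) i -
    (delta (index x s) i + delta (index y s) i).
  have := wrel u; rewrite -(hs _ (Es _ xE)) -(hs _ (Es _ yE)) -(hs _ xys).
  rewrite -big_split /=.
  under eq_bigr => i _ do rewrite mulrzBr mulrzDr.
  rewrite sumrB big_split /= !eval_at ?(Es x) ?(Es y) // subrr => /(_ erefl) e.
  apply/eqP; rewrite -subr_eq0 -sumrB -[X in _ == X]e; apply/eqP.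
  by apply: eq_bigr => i _; rewrite /u; ring.
have xi : (index x s < size s)%N by rewrite index_mem.
have := wsep (Ordinal xi); rewrite /= eval_at // hs //.
by move=> h0 /eqP e; apply/eqP/negP => /negP /h0; rewrite e.
Qed.

End TorsionFreeZmodule.

Lemma torsion_free_abelian_weight (A : groupType) (E : seq A) :
    abelian_group A -> torsion_free A ->
  exists h : A -> int, {in E &, forall x y, h (x * y)%g = h x + h y} /\
                       {in E, forall x, h x = 0 -> x = 1%g}.
Proof.
move=> AC Atf.
pose addA := GRing.isZmodule.Build A (@mulgA A) AC (@mul1g A) (@mulVg A).
pose V : zmodType := HB.pack (A : Type) (Choice.on A) addA.
(* Multiples in V are convertible to powers in A. *)
have [//|h hP] := @zmod_local_weight V _ E.
by exists h.
Qed.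

End TorsionFreeWeights.

(** * Free subgroups of infinite rank in the free group of rank 2 *)

Section IntegerPowers.
Context (G : groupType).
Local Open Scope group_scope.

Definition zpowg (x : G) (n : int) : G :=
  match n with Posz m => x ^+ m | Negz m => x ^- m.+1 end.

Lemma zpowgS x (n : int) : zpowg x (n + 1)%R = zpowg x n * x.
Proof.
case: n => n; first by rewrite -PoszD addn1 /= expgSr.
have -> : (Negz n + 1)%R = (- n%:Z)%R by rewrite NegzE; lia.
have -> : zpowg x (- n%:Z)%R = x ^- n.
  by case: n => [|n] //; rewrite expg0 invg1.
by rewrite /= expgS invgM mulgVK.
Qed.

Lemma zpowgD x : {morph zpowg x : m n / (m + n)%R >-> m * n}.
Proof.
move=> m; elim/int_rect => [|n IH|n IH]; first by rewrite addr0 mulg1.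
  by rewrite -addn1 PoszD addrA !zpowgS IH mulgA.
apply: (mulIg x); rewrite -mulgA -!zpowgS.
have -> : (- n.+1%:Z + 1)%R = (- n%:Z)%R by lia.
by rewrite -IH; congr (zpowg x _); lia.
Qed.

Lemma zpowg_additive (u : int -> G) (n : int) :
  {morph u : m n / (m + n)%R >-> m * n} -> zpowg (u 1%R) n = u n.
Proof.
move=> uD; have u0 : u 0%R = 1.
  by apply: (mulgI (u 0%R)); rewrite -uD addr0 mulg1.
elim/int_rect: n => [|n IH|n IH]; first by rewrite u0.
  by rewrite -addn1 PoszD zpowgS IH uD.
apply: (mulIg (u 1%R)); rewrite -zpowgS -uD.
by have -> : (- n.+1%:Z + 1)%R = (- n%:Z)%R by lia.
Qed.

End IntegerPowers.

Section Bijections.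
Context (T : Type).

Record bijection := Bijection {
  bij_fun :> T -> T;
  bij_inv : T -> T;
  bij_funK : cancel bij_fun bij_inv;
  bij_invK : cancel bij_inv bij_fun }.

Lemma bijection_ext (f g : bijection) : f =1 g -> f = g.
Proof.
case: f g => [f f' fK f'K] [g g' gK g'K] /= /funext e.
case: g / e gK g'K => gK g'K.
have /funext e' : f' =1 g' by move=> x; rewrite -{1}(g'K x) fK.
by case: g' / e' gK g'K => gK g'K; congr Bijection; apply: Prop_irrelevance.
Qed.

HB.instance Definition _ := gen_eqMixin bijection.
HB.instance Definition _ := gen_choiceMixin bijection.

Definition bij_mul (f g : bijection) : bijection :=
  Bijection (can_comp (bij_funK f) (bij_funK g))
            (can_comp (bij_invK g) (bij_invK f)).
Definition bij_one : bijection := Bijection (frefl id) (frefl id).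
Definition bij_inverse (f : bijection) : bijection :=
  Bijection (bij_invK f) (bij_funK f).

Lemma bij_mulA : associative bij_mul.
Proof. by move=> f g h; apply: bijection_ext. Qed.
Lemma bij_mul1 : left_id bij_one bij_mul.
Proof. by move=> f; apply: bijection_ext. Qed.
Lemma bij_mulr1 : right_id bij_one bij_mul.
Proof. by move=> f; apply: bijection_ext. Qed.
Lemma bij_mulV : left_inverse bij_one bij_inverse bij_mul.
Proof. by move=> f; apply: bijection_ext => x /=; rewrite bij_funK. Qed.
Lemma bij_mulrV : right_inverse bij_one bij_inverse bij_mul.
Proof. by move=> f; apply: bijection_ext => x /=; rewrite bij_invK. Qed.

HB.instance Definition _ := isGroup.Build bijection
  bij_mulA bij_mul1 bij_mulr1 bij_mulV bij_mulrV.

Lemma bij_mulE (f g : bijection) x : (f * g)%g x = f (g x).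
Proof. by []. Qed.

End Bijections.

(** Elements of the free group are told apart by an action in the spirit of the
  Magnus embedding, which represents a free generator by 1 + N. The vectors are
  the integer valued functions on the words with letters in the integers. For
  each letter [i] the operator [N_i] takes [v] to the function with value
  [v (i :: s)] at [s], or 0 if [s] begins with [i]; this exception makes [N_i]
  of square zero, so that (1 + N_i)^n = 1 + n N_i. A product of such operators
  with distinct neighbouring indices has as its term of highest degree the
  product of the exponents times the product of the [N_i], and the latter is
  nonzero. Translating all letters by [i] conjugates [N_0] to [N_i], which is
  why two generators are enough. *)
Section Magnus.
Local Open Scope ring_scope.
Notation V := (seq int -> int).

Definition shift_fun (m : int) (v : V) : V := fun s => v [seq t + m | t <- s].

Lemma shift_funD m n v : shift_fun m (shift_fun n v) = shift_fun (m + n) v.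
Proof.
rewrite /shift_fun; apply/funext => s; rewrite -map_comp.
by congr v; apply: eq_map => t /=; rewrite addrA.
Qed.

Lemma shift_fun0 v : shift_fun 0 v = v.
Proof.
rewrite /shift_fun; apply/funext => s.
by rewrite (eq_map (@addr0 _)) map_id.
Qed.

Lemma shift_funK m : cancel (shift_fun m) (shift_fun (- m)).
Proof. by move=> v; rewrite shift_funD addNr shift_fun0. Qed.

Lemma shift_funNK m : cancel (shift_fun (- m)) (shift_fun m).
Proof. by move=> v; rewrite shift_funD addrN shift_fun0. Qed.

Definition shift m : bijection V := Bijection (shift_funK m) (shift_funNK m).

Definition transvection_fun (i n : int) (v : V) : V :=
  fun s => v s + n * ((ohead s != Some i)%:R * v (i :: s)).

Lemma transvection_funD i m n v :
  transvection_fun i m (transvection_fun i n v) = transvection_fun i (m + n) v.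
Proof.
apply/funext => s; rewrite /transvection_fun /= eqxx /=; ring.
Qed.

Lemma transvection_fun0 i v : transvection_fun i 0 v = v.
Proof. by apply/funext => s; rewrite /transvection_fun mul0r addr0. Qed.

Lemma transvection_funK i n :
  cancel (transvection_fun i n) (transvection_fun i (- n)).
Proof. by move=> v; rewrite transvection_funD addNr transvection_fun0. Qed.

Lemma transvection_funNK i n :
  cancel (transvection_fun i (- n)) (transvection_fun i n).
Proof. by move=> v; rewrite transvection_funD addrN transvection_fun0. Qed.

Definition transvection i n : bijection V :=
  Bijection (transvection_funK i n) (transvection_funNK i n).

(** Translation conjugates one transvection to all the others. *)
Lemma transvectionJ i n :
  transvection i n = (shift (- i) * (transvection 0 n * shift i))%g.
Proof.
apply: bijection_ext => v; apply/funext => s.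
rewrite !bij_mulE /= /transvection_fun /shift_fun /= add0r -map_comp.
rewrite (eq_map (@subrK _ i)) map_id; congr (_ + n * (_%:R * _)).
by case: s => //= t s; rewrite !(inj_eq Some_inj) subr_eq0.
Qed.

Definition transvections (w : seq (int * int)) : bijection V :=
  (\prod_(p <- w) transvection p.1 p.2)%g.

Lemma transvections_cons p w v s : transvections (p :: w) v s =
  transvections w v s +
  p.2 * ((ohead s != Some p.1)%:R * transvections w v (p.1 :: s)).
Proof. by rewrite /transvections big_cons. Qed.

(** Each operator in the product lengthens the word at which [v] is evaluated by
  at most one letter. *)
Lemma transvections_low w v s :
    (forall s', (size s' <= size w + size s)%N -> v s' = 0) ->
  transvections w v s = 0.
Proof.
elim: w s => [|p w IH] s v0; first by rewrite /transvections big_nil; apply: v0.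
rewrite transvections_cons !IH ?mulr0 ?addr0 // => s' /= s's; apply: v0 => /=.
  by rewrite addSn -addnS.
by rewrite addSn leqW.
Qed.

(** At the length where [v] starts to be nonzero, only the term of highest
  degree of the product contributes, the others evaluating [v] at shorter
  words. The hypotheses on neighbouring letters say that the exceptional case in
  the definition of [N_i] does not occur. *)
Lemma transvections_lead w v s :
    (forall s', (size s' < size w + size s)%N -> v s' = 0) ->
    sorted (fun i j => i != j) (unzip1 w) -> ohead s != ohead (unzip1 w) ->
  transvections w v s = (\prod_(p <- w) p.2) * v (catrev (unzip1 w) s).
Proof.
elim: w s => [|p w IH] s v0 ws sw.
  by rewrite /transvections !big_nil mul1r.
rewrite transvections_cons transvections_low ?add0r; last first.
  by move=> s' s's; apply: v0; rewrite /= addSn ltnS.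
rewrite /= in sw; rewrite sw mul1r big_cons IH ?mulrA //.
- by move=> s' /=; rewrite addnS -addSn; apply: v0.
- exact: path_sorted ws.
- by case: w ws {IH v0} => [|q w] //= /andP[].
Qed.

Lemma transvections_neq1 w :
    w != [::] -> sorted (fun i j => i != j) (unzip1 w) ->
    {in w, forall p : int * int, p.2 != 0} ->
  transvections w <> 1%g.
Proof.
move=> w0 ws wn e.
(* The indicator function of the one word that the leading term evaluates. *)
pose v (s : seq int) : int := (s == rev (unzip1 w))%:R.
have v0 s' : (size s' < size w + 0)%N -> v s' = 0.
  rewrite addn0 /v; case: eqP => // ->.
  by rewrite size_rev size_map ltnn.
have := @transvections_lead w v [::] v0 ws.
rewrite e {1}/v /= -/(rev _) /v eqxx mulr1.
case: w w0 {ws e v v0} wn => // p w _ wn /(_ isT).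
have -> : ([::] == rev (unzip1 (p :: w))) = false.
  by rewrite eq_sym -size_eq0 size_rev.
move=> /esym/eqP.
by apply/negP; rewrite prodf_seq_neq0; apply/allP => q /wn.
Qed.

End Magnus.

Section FreeGroupRank2.
Local Open Scope group_scope.
Let x : free_group 'I_2 := free_gen ord0.
Let y : free_group 'I_2 := free_gen (lift ord0 ord0).

Definition conj_gen (i : int) : free_group 'I_2 :=
  zpowg x (- i)%R * (y * zpowg x i).

(** The elements [conj_gen i] are free generators of the subgroup that they
  generate: they act on functions of words by the transvections, hence a
  reduced product of their powers does not act trivially. *)
Lemma conj_gen_prod_neq1 (w : seq (int * int)) :
    w != [::] -> sorted (fun i j => i != j) (unzip1 w) ->
    {in w, forall p : int * int, p.2 != 0%R} ->
  \prod_(p <- w) zpowg (conj_gen p.1) p.2 <> 1.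
Proof.
move=> w0 ws wn.
have [g gE] := free_group_lift
  (fun i : 'I_2 => if i == ord0 then shift 1 else transvection 0 1).
have gx : g x = shift 1 by rewrite gE.
have gy : g y = transvection 0 1 by rewrite gE.
have g1 : g 1 = 1 by apply: (mulgI (g 1)); rewrite -gmulfM !mulg1.
have gpow z n : g (zpowg z n) = zpowg (g z) n.
  rewrite -[LHS](@zpowg_additive _ (fun n => g (zpowg z n))) //.
  by move=> m n'; rewrite -gmulfM zpowgD.
have gc i : g (conj_gen i) = transvection i 1.
  rewrite transvectionJ !gmulfM !gpow gx gy.
  by rewrite !zpowg_additive // => m n; apply: bijection_ext => v;
    rewrite bij_mulE /= shift_funD.
move=> /(congr1 g); rewrite g1 (big_morph g (@gmulfM _ _ g) g1).
under eq_bigr => p _.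
  rewrite gpow gc zpowg_additive; last first.
    move=> m n; apply: bijection_ext => v.
    by rewrite bij_mulE /= transvection_funD.
  over.
exact: transvections_neq1.
Qed.

End FreeGroupRank2.

(** * Words in a free product *)

Section FreeProductWords.
Context (I : Type) (A : I -> groupType).
Local Open Scope group_scope.
Notation L := {i : I & A i}.
Notation linv := (fun l : L => letter (projT2 l)^-1).
Notation weq := (word_eq linv (@free_product_rel I A)).

(* Membership of a letter in a sequence needs an equality test: hence the
   cast. *)
Notation cletter a := (letter a : {classic L}).

Definition multiplicative_on (H : groupType) (E : seq {classic L})
    (f : L -> H) :=
  forall i (a b : A i), cletter a \in E -> cletter b \in E ->
    f (letter (a * b)) = f (letter a) * f (letter b).

Lemma multiplicative_on1 (H : groupType) (E : seq {classic L}) (f : L -> H) i :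
  cletter (1 : A i) \in E -> multiplicative_on E f -> f (letter (1 : A i)) = 1.
Proof.
by move=> E1 fM; apply: (mulgI (f (letter (1 : A i)))); rewrite -fM // !mulg1.
Qed.

Lemma multiplicative_on_sub (H : groupType) (E E' : seq {classic L})
    (f : L -> H) :
  {subset E <= E'} -> multiplicative_on E' f -> multiplicative_on E f.
Proof. by move=> sE fM i a b /sE aE /sE bE; apply: fM. Qed.

(** A derivation of an equality of words is finite, hence uses finitely many
  letters. *)
Lemma word_eq_local u v : weq u v ->
  exists E : seq {classic L}, forall (H : groupType) (f : L -> H),
    multiplicative_on E f -> \prod_(l <- u) f l = \prod_(l <- v) f l.
Proof.
elim=> {u v} [u v [i a b|i]|[i a]|[i a]|u u' v v' _ [E1 h1] _ [E2 h2]
  |u|u v _ [E h]|u v w _ [E1 h1] _ [E2 h2]].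
- exists [:: letter a; letter b] => H f fM.
  by rewrite !big_cons !big_nil !mulg1 fM ?inE ?eqxx ?orbT.
- exists [:: letter (1 : A i)] => H f fM.
  by rewrite !big_cons !big_nil !mulg1 (multiplicative_on1 _ fM) ?inE.
- exists [:: letter (1 : A i); letter a; letter a^-1] => H f fM.
  rewrite !big_cons !big_nil !mulg1 -fM ?inE ?eqxx ?orbT // mulgV.
  by rewrite (multiplicative_on1 _ fM) ?inE ?eqxx.
- exists [:: letter (1 : A i); letter a; letter a^-1] => H f fM.
  rewrite !big_cons !big_nil !mulg1 -fM ?inE ?eqxx ?orbT // mulVg.
  by rewrite (multiplicative_on1 _ fM) ?inE ?eqxx.
- exists (E1 ++ E2) => H f fM; rewrite !big_cat /=.
  by congr (_ * _); [apply: h1|apply: h2];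
    apply: multiplicative_on_sub fM => l lE; rewrite mem_cat lE ?orbT.
- by exists [::].
- by exists E => H f /h.
- exists (E1 ++ E2) => H f fM; transitivity (\prod_(l <- v) f l).
    by apply: h1; apply: multiplicative_on_sub fM => l lE; rewrite mem_cat lE.
  apply: h2; apply: multiplicative_on_sub fM => l lE.
  by rewrite mem_cat lE orbT.
Qed.

Lemma word_eqs_local (S : seq (seq {classic L} * seq {classic L})) :
    {in S, forall uv, weq uv.1 uv.2} ->
  exists E : seq {classic L}, forall (H : groupType) (f : L -> H),
    multiplicative_on E f ->
    {in S, forall uv, \prod_(l <- uv.1) f l = \prod_(l <- uv.2) f l}.
Proof.
elim: S => [|uv S IH] hS; first by exists [::].
have [E1 h1] := word_eq_local (hS uv (mem_head _ _)).
have [|E2 h2] := IH; first by move=> x xS; apply: hS; rewrite inE xS orbT.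
exists (E1 ++ E2) => H f fM x; rewrite inE => /orP[/eqP ->|xS].
  by apply: h1; apply: multiplicative_on_sub fM => l lE; rewrite mem_cat lE.
apply: h2 => //.
by apply: multiplicative_on_sub fM => l lE; rewrite mem_cat lE orbT.
Qed.

Definition reduced (w : seq {classic L}) :=
  {in w, forall l : {classic L}, projT2 l <> 1} /\
  sorted (fun i j => i != j)
    [seq (projT1 l : {classic I}) | l : {classic L} <- w].

(** Letters are prepended one by one, merging each with the first letter of the
  reduced word when both come from the same factor. *)
Lemma word_reduced (u : seq L) :
  exists2 w : seq {classic L}, weq u w & reduced w.
Proof.
elim: u => [|[i a] u [w uw [w1 ws]]].
  by exists [::]; [apply: WordRefl|split].
have uw' : weq (letter a :: u) (letter a :: w).
  by apply: (@WordCat _ _ _ [:: _] [:: _]) uw; apply: WordRefl.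
have [a1|a1] := pselect (a = 1).
  exists w => //; apply: WordTrans uw' _; rewrite a1.
  apply: (@WordCat _ _ _ [:: _] [::] w w); last exact: WordRefl.
  exact/WordRel/FreeProductOne.
case: w w1 ws uw uw' => [|[j b] w] w1 ws uw uw'.
  by exists [:: letter a] => //; split=> // l; rewrite inE => /eqP ->.
have w1' : {in w, forall l : {classic L}, projT2 l <> 1}.
  by move=> l lw; apply: w1; rewrite inE lw orbT.
have [ij|ij] := pselect (i = j); last first.
  exists [:: letter a, letter b & w] => //; split=> /=.
    by move=> l; rewrite inE => /orP[/eqP -> //|]; apply: w1.
  by apply/andP; split=> //; apply/eqP.
case: j / ij b w1 ws uw uw' => b w1 ws uw uw'.
have uw2 : weq (letter a :: u) (letter (a * b) :: w).
  apply: WordTrans uw' _.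
  apply: (@WordCat _ _ _ [:: _; _] [:: _] w w); last exact: WordRefl.
  exact/WordRel/FreeProductMul.
have [ab1|ab1] := pselect (a * b = 1).
  exists w; last by split=> //; apply: path_sorted ws.
  apply: WordTrans uw2 _; rewrite ab1.
  apply: (@WordCat _ _ _ [:: _] [::] w w); last exact: WordRefl.
  exact/WordRel/FreeProductOne.
exists (letter (a * b) :: w) => //; split=> // l.
by rewrite inE => /orP[/eqP ->|/w1'].
Qed.

(** * Local embeddings of free products *)

Lemma letter_inj i : injective (@letter I A i).
Proof. by move=> a b; apply: (@existT_inj2 {classic I}). Qed.

Lemma letters_of_index (E : seq {classic L}) (i : I) :
  exists Ei : seq (A i), forall a : A i, cletter a \in E -> a \in Ei.
Proof.
elim: E => [|[j b] E [Ei IH]]; first by exists [::].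
have [ij|ij] := pselect (j = i).
  case: i / ij Ei IH => Ei IH; exists (b :: Ei) => a.
  rewrite !inE => /orP[/eqP/letter_inj -> |/IH ->]; rewrite ?eqxx ?orbT //.
exists Ei => a; rewrite inE => /orP[/eqP e|/IH //].
by case: ij; rewrite (existT_inj1 e).
Qed.

(** The set [S] lists the equalities of words that the local embedding has to
  respect. Those of the first kind make it multiplicative on [E]; those of the
  second kind express [y] through [x] and a reduced word for [x^-1 y], whose
  image is trivial if [x] and [y] have the same image. *)
Lemma free_product_locally_embeds :
    (forall i, abelian_group (A i) /\ torsion_free (A i)) ->
  locally_embeds (free_product A) (free_group 'I_2).
Proof.
move=> Atf E.
pose R (g : free_product A) : seq {classic L} := (repr g : seq L).
have /choice[red redP] (g : free_product A) : exists w : seq {classic L},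
    word_class _ _ w = g /\ reduced w.
  have [w gw wred] := word_reduced (R g); exists w; split=> //.
  by rewrite -[RHS]word_class_repr; apply/word_classP/WordSym.
pose S := [seq (R (x * y), R x ++ R y) | x <- E, y <- E] ++
          [seq (R y, R x ++ red (x^-1 * y)) | x <- E, y <- E].
have [|E1 E1P] := @word_eqs_local S.
  move=> uv; rewrite mem_cat => /orP[] /allpairsP[[x y] /= [_ _ ->]] /=.
    apply/word_classP; rewrite [RHS]word_classM.
    by rewrite ![in RHS]word_class_repr; apply: word_class_repr.
  apply/word_classP; rewrite [RHS]word_classM (redP _).1.
  rewrite [X in X * _]word_class_repr mulgA mulgV mul1g.
  exact: word_class_repr.
(* The weights must be additive on E1 and nonzero on the letters of the reduced
   words. *)
pose E2 := E1 ++ flatten [seq red (x^-1 * y) | x <- E, y <- E].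
have /(_ _)/cid hE i : exists h : A i -> int,
    (forall a b : A i, cletter a \in E2 -> cletter b \in E2 ->
       h (a * b) = (h a + h b)%R) /\
    (forall a : A i, cletter a \in E2 -> h a = 0%R -> a = 1).
  have [Ei EiP] := letters_of_index E2 i.
  have [AC Afree] := Atf i.
  have [h [hD h0]] := torsion_free_abelian_weight Ei AC Afree.
  by exists h; split=> [a b /EiP aE /EiP bE|a /EiP]; [apply: hD|apply: h0].
pose h i := projT1 (hE i).
have hD i := (projT2 (hE i)).1; have h0 i := (projT2 (hE i)).2.
(* There may be infinitely many factors: the index of a factor is its position
   among those that occur in E2. *)
pose dom := [seq (projT1 l : {classic I}) | l : {classic L} <- E2].
pose idx (l : L) : int := index (projT1 l : {classic I}) dom.
pose f (l : L) := zpowg (conj_gen (idx l)) (h (projT1 l) (projT2 l)).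
have fM : multiplicative_on E1 f.
  move=> i a b aE bE; rewrite -zpowgD -hD // mem_cat ?aE ?bE //.
pose phi (g : free_product A) := \prod_(l <- R g) f l.
have {}E1P := E1P _ f fM.
exists phi; split=> x y xE yE.
  rewrite /phi -big_cat; apply: (E1P (_, _)).
  by rewrite mem_cat allpairs_f.
move=> exy; have xyS : (R y, R x ++ red (x^-1 * y)) \in S.
  by rewrite mem_cat; apply/orP; right; apply: allpairs_f.
have := E1P _ xyS; rewrite /= big_cat -/(phi y) -/(phi x) exy.
set w := red _; have [wE [w1 ws]] := redP (x^-1 * y); rewrite -/w in wE w1 ws.
move=> e; have {e} fw : \prod_(l <- w) f l = 1.
  by apply: (mulgI (phi y)); rewrite mulg1 -e.
have wE2 : {subset w <= E2}.
  move=> l lw; rewrite mem_cat; apply/orP; right; apply/flattenP.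
  by exists w => //; apply: allpairs_f.
have [w0|w0] := eqVneq w [::]; last first.
  case: (@conj_gen_prod_neq1
    [seq (idx l, h (projT1 l) (projT2 l)) | l : {classic L} <- w]).
  - by case: (w) w0.
  - rewrite /unzip1 -map_comp (map_comp (fun i => Posz (index i dom))).
    apply: (homo_sorted_in (P := [in dom]) _ _ ws).
      by move=> i j iE jE; apply: contra => /eqP[/index_inj ->].
    by apply/allP => _ /mapP[l /wE2 lE ->]; apply: map_f.
  - move=> _ /mapP[[i a] lw ->] /=; apply/eqP => /h0 a1.
    by apply: (w1 _ lw); apply: a1; apply: wE2.
  - by rewrite big_map.
by apply: (mulgI x^-1); rewrite mulVg -wE w0.
Qed.

End FreeProductWords.

Theorem proposition17 (K : fieldType -> Prop) :
  class_resistant K (free_group 'I_2) ->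
  forall (I : Type) (A : I -> groupType),
    (forall i : I, abelian_group (A i) /\ torsion_free (A i)) ->
    class_resistant K (free_product A).
Proof.
move=> F2 I A Atf k Kk; apply: locally_embeds_resistant (F2 k Kk).
exact: free_product_locally_embeds.
Qed.
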